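(* Let $r \ge 1$ be an integer. A sequence $B=[b_1,b_2,\ldots,b_n]$ of integers in non-decreasing order ($b_1\le b_2\le\cdots\le b_n$) is the imbalance sequence of some $r$-graph if and only if $$\sum_{i=1}^{k} b_i \ge rk(k-n)\qquad\text{for all } 1\le k\le n,$$ with equality when $k=n$.
   Context: For an integer $r\ge 1$, an $r$-graph (short for $r$-digraph) is a finite directed multigraph without loops in which any two distinct vertices are joined by at most $r$ arcs in total (counting arcs in both directions). The imbalance of a vertex $v$ is $b_v=d_v^{+}-d_v^{-}$, where $d_v^{+}$ and $d_v^{-}$ are the outdegree and indegree of $v$ (counted with multiplicity). The imbalance sequence of an $r$-graph is the list of the imbalances of its vertices (one entry per vertex) in non-decreasing order. *)

(* Defs.v *)
From mathcomp Require Import all_boot all_order all_algebra.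

Set Implicit Arguments.
Unset Strict Implicit.
Unset Printing Implicit Defensive.

Import Order.TTheory GRing.Theory Num.Theory.
Local Open Scope ring_scope.

(* A finite directed multigraph is encoded by its arc multiplicities:
   [arcs u v] is the number of arcs from u to v. *)
Record rdigraph (r : nat) := RDigraph {
  vertex : finType;
  arcs : vertex -> vertex -> nat;
  arcs_loopless : forall v, arcs v v = 0%N;
  arcs_bound : forall u v, u != v -> (arcs u v + arcs v u <= r)%N
}.

Section Imbalance.

Variables (r : nat) (G : rdigraph r).

Definition outdegree (v : vertex G) : nat := (\sum_w arcs v w)%N.

Definition indegree (v : vertex G) : nat := (\sum_w arcs w v)%N.

Definition imbalance (v : vertex G) : int :=
  (outdegree v)%:Z - (indegree v)%:Z.

Definition imbalance_sequence : seq int :=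
  sort <=%R [seq imbalance v | v <- enum (vertex G)].

End Imbalance.

(* Main.v *)
(** Only the differences [x u v = arcs u v - arcs v u] matter: they range over
    the skew-symmetric integer matrices with entries at least [-r], and the
    imbalances are the row sums.  Inside a set [S] of vertices the entries
    cancel, so the row sums over [S] total at least [-r |S| (n - |S|)].
    Conversely, take such a matrix and a vertex whose row sum is too large.
    Moving one unit along entries larger than [-r], from [u] to [v], lowers the
    row sum of [u] and raises that of [v].  Either some vertex whose row sum is
    too small can be reached in this way, and an augmenting path brings the row
    sums closer to the target, or all the entries leaving the set of reachable
    vertices are [-r], and this set violates the inequality. *)

Require Import Defs.
From mathcomp Require Import all_boot all_order all_algebra.
From mathcomp Require Import zify.

Set Implicit Arguments.
Unset Strict Implicit.
Unset Printing Implicit Defensive.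

Import Order.TTheory GRing.Theory Num.Theory.
Local Open Scope ring_scope.

Section SkewMatrices.

Variables (T : finType) (r : nat).
Implicit Types (x : T -> T -> int) (S : {set T}).

(** The upper bound [r] on the entries follows from the lower one by skew symmetry. *)
Definition skew_ge x :=
  (forall u v, x v u = - x u v) /\ (forall u v, - r%:Z <= x u v).

Definition row_sum x u : int := \sum_w x u w.

Lemma skew_sum_row_sum x S : skew_ge x ->
  \sum_(u in S) row_sum x u = \sum_(u in S) \sum_(w in ~: S) x u w.
Proof.
case=> xN _; have inner0 : \sum_(u in S) \sum_(w in S) x u w = 0.
  have : \sum_(u in S) \sum_(w in S) x u w =
         - \sum_(u in S) \sum_(w in S) x u w.
    rewrite [LHS]exchange_big /= -sumrN; apply: eq_bigr => u _.
    by rewrite -sumrN; apply: eq_bigr => w _; rewrite xN.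
  lia.
pose F u := \sum_(w in S) x u w + \sum_(w in ~: S) x u w.
rewrite (eq_bigr F) => [|u _]; first by rewrite big_split /= inner0 add0r.
rewrite /row_sum (bigID (mem S)) /=; congr (_ + _).
by apply: eq_bigl => w; rewrite inE.
Qed.

(** For [c] equal to [-r] this is the right-hand side of the theorem, read as the least possible
    total over the cut. *)
Lemma sum_cut_const S (c : int) :
  \sum_(u in S) \sum_(w in ~: S) c = - c * #|S|%:Z * (#|S|%:Z - #|T|%:Z).
Proof.
rewrite !sumr_const -mulrnA -mulr_natr natrM -(cardsC S) PoszD !natz.
nia.
Qed.

Lemma skew_sum_row_sum_ge x S : skew_ge x ->
  \sum_(u in S) row_sum x u >= r%:Z * #|S|%:Z * (#|S|%:Z - #|T|%:Z).
Proof.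
move=> xP; rewrite skew_sum_row_sum // -[r%:Z]opprK -sum_cut_const.
by apply: ler_sum => u _; apply: ler_sum => w _; apply: xP.2.
Qed.

Lemma skew_sum_row_sum0 x : skew_ge x -> \sum_u row_sum x u = 0.
Proof.
move=> xP; have := skew_sum_row_sum setT xP.
under eq_bigl do rewrite inE; move=> ->; rewrite big1 // => u _.
by rewrite setCT big_set0.
Qed.

Definition residual x : rel T := [rel u v | (u != v) && (- r%:Z < x u v)].

Definition push x u v : T -> T -> int := fun a c =>
  x a c - ((a == u) && (c == v))%:Z + ((a == v) && (c == u))%:Z.

Lemma push_skew x u v : skew_ge x -> residual x u v -> skew_ge (push x u v).
Proof.
move=> [xN xge] /andP[nuv xuv]; split=> a c; rewrite /push.
  by rewrite (xN a c) ![(c == _) && _]andbC; lia.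
have := xge a c.
case: (a =P u) => [->|_]; case: (c =P v) => [->|_] /=; lia.
Qed.

Lemma row_sum_push x u v a :
  row_sum (push x u v) a = row_sum x a - (a == u)%:Z + (a == v)%:Z.
Proof.
have sum_delta b z : \sum_w (b && (w == z))%:Z = b%:Z :> int.
  rewrite (bigD1 z) //= eqxx andbT big1 ?addr0 // => w /negPf->.
  by rewrite andbF.
by rewrite /row_sum /push big_split sumrB /= !sum_delta.
Qed.

(** Each inner vertex of the path receives a unit and passes it on, so only the two ends change. *)
Lemma augment_path x u p : skew_ge x -> path (residual x) u p ->
  uniq (u :: p) ->
  exists2 y, skew_ge y &
    forall a, row_sum y a = row_sum x a - (a == u)%:Z + (a == last u p)%:Z.
Proof.
elim: p x u => [|v p IHp] x u xP /=.
  by move=> _ _; exists x => // a; lia.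
move=> /andP[ruv vp] /andP[up /andP[vnp unp]].
(* Pushing along (u, v) only shrinks the residual relation at u, and the rest
   of the path avoids u. *)
have vp' : path (residual (push x u v)) v p.
  apply: (sub_in_path (P := [pred a | a != u])) vp.
    move=> a c /= nau ncu /andP[nac]; rewrite /residual /push /= nac.
    by rewrite (negPf nau) (negPf ncu) andbF subr0 addr0.
  by apply/allP=> a ap /=; apply: contraNneq up => <-.
have [|y yP yrow] := IHp _ _ (push_skew xP ruv) vp'; first by rewrite /= vnp.
by exists y => // a; rewrite yrow row_sum_push; lia.
Qed.

Variable b : T -> int.
Hypothesis b_sum0 : \sum_u b u = 0.
Hypothesis b_cut : forall S,
  \sum_(u in S) b u >= r%:Z * #|S|%:Z * (#|S|%:Z - #|T|%:Z).

Lemma exists_augmenting x u : skew_ge x -> b u < row_sum x u ->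
  exists2 v, connect (residual x) u v & row_sum x v < b v.
Proof.
move=> xP bu; have [/existsP[v /andP[]]|/existsPn nov] :=
  boolP [exists v, connect (residual x) u v && (row_sum x v < b v)].
  by exists v.
pose S := [set v | connect (residual x) u v].
have geS v : v \in S -> b v <= row_sum x v.
  by rewrite inE => uv; have := nov v; rewrite uv /= -leNgt.
(* An entry above [-r] leaving [S] would make its target reachable, so the cut bound is attained. *)
have sumS : \sum_(v in S) row_sum x v = r%:Z * #|S|%:Z * (#|S|%:Z - #|T|%:Z).
  rewrite skew_sum_row_sum // -[r%:Z]opprK -sum_cut_const.
  apply: eq_bigr => v; rewrite inE => uv; apply: eq_bigr => w; rewrite !inE => uw.
  apply/eqP; rewrite eq_le xP.2 andbT leNgt; apply: contra (uw) => xvw.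
  apply: connect_trans (uv) (connect1 _); rewrite /residual /= xvw andbT.
  by apply: contraNneq uw => <-.
have uS : u \in S by rewrite inE connect0.
(* The strict excess at [u] makes the sum of [b] over [S] fall below the cut bound. *)
have := b_cut S; rewrite -sumS (bigD1 u) //= [leRHS](bigD1 u) //=.
have : \sum_(v in S | v != u) b v <= \sum_(v in S | v != u) row_sum x v.
  by apply: ler_sum => v /andP[/geS].
by move=> le1; rewrite leNgt ltr_leD.
Qed.

Lemma exists_skew_row_sum :
  exists2 x, skew_ge x & forall u, row_sum x u = b u.
Proof.
pose defect x : int := \sum_u `|row_sum x u - b u|.
(* Induction on a strict bound for the defect, starting from the zero matrix. *)
suff H m x : skew_ge x -> defect x < m%:Z ->
    exists2 y, skew_ge y & forall u, row_sum y u = b u.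
  apply: (H `|defect (fun _ _ => 0)|.+1 (fun _ _ => 0)); last by lia.
  by split=> *; lia.
elim: m x => [|m IHm] x xP xm.
  have : 0 <= defect x by apply: sumr_ge0.
  lia.
have [/existsP[u bu]|/existsPn nou] := boolP [exists u, b u < row_sum x u].
  have [v /connectP[p up ev] bv] := exists_augmenting xP bu.
  case/shortenP: up ev => q uq unq _ ev.
  have [y yP yrow] := augment_path xP uq unq.
  (* The term of the defect at [u] falls by one, the one at [v] does not grow, and the others
     stay. *)
  apply: (IHm y yP); apply: lt_le_trans (_ : defect x <= _); last by lia.
  have nvu : (u == v) = false.
    by apply: contraTF bu => /eqP->; rewrite -leNgt ltW.
  rewrite /defect (bigD1 u) //= [ltRHS](bigD1 u) //=.
  apply: ltr_leD; first by rewrite yrow -ev eqxx nvu; lia.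
  apply: ler_sum => a /negPf nau; rewrite yrow -ev nau.
  by case: (a =P v) => [->|_]; lia.
(* No row sum exceeds its target and both totals are zero, so all the differences vanish. *)
exists x => // u; apply/eqP; rewrite eq_sym -subr_eq0.
have /psumr_eq0P -> // : \sum_u (b u - row_sum x u) = 0.
  by rewrite sumrB b_sum0 skew_sum_row_sum0.
by move=> v _; rewrite subr_ge0 leNgt nou.
Qed.

End SkewMatrices.

(** This extends the inequalities of the theorem from initial segments to all vertex sets. *)
Lemma sum_initial_le (n k : nat) (c : nat -> int) (S : {set 'I_n}) :
  (forall i j, (i <= j < n)%N -> c i <= c j) -> #|S| = k ->
  \sum_(i < k) c i <= \sum_(i in S) c i.
Proof.
move=> cP Sk.
have kn : (k <= n)%N by rewrite -Sk -[n in (_ <= n)%N]card_ord max_card.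
case: k => [|k] in Sk kn *.
  by rewrite big_ord0 (cards0_eq Sk) big_set0.
(* Subtracting the pivot c k turns the claim into a termwise comparison. *)
rewrite -subr_ge0.
have -> : \sum_(i in S) c i - \sum_(i < k.+1) c i =
          \sum_(i in S) (c i - c k) - \sum_(i < k.+1) (c i - c k).
  by rewrite !sumrB !sumr_const Sk card_ord opprB addrA subrK.
rewrite subr_ge0 (big_ord_widen n (fun i => c i - c k)) //.
rewrite big_mkcond [leRHS]big_mkcond /=; apply: ler_sum => i _.
(* Terms up to the pivot are nonpositive and all counted on the left; later ones are nonnegative and
   absent there. *)
have [ik|ki] := ltnP i k.+1.
  have /cP : (i <= k < n)%N by rewrite -ltnS ik.
  by case: ifP; lia.
have /cP : (k <= i < n)%N by rewrite ltn_ord ltnW.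
by case: ifP; lia.
Qed.

Definition net (r : nat) (G : rdigraph r) (u v : vertex G) : int :=
  (arcs u v)%:Z - (arcs v u)%:Z.

Lemma net_skew (r : nat) (G : rdigraph r) : skew_ge r (@net r G).
Proof.
split=> u v; rewrite /net; first by lia.
have [->|/(@arcs_bound _ G)] := eqVneq u v; lia.
Qed.

Lemma imbalanceE (r : nat) (G : rdigraph r) (v : vertex G) :
  imbalance v = row_sum (@net r G) v.
Proof. by rewrite /row_sum sumrB -!(big_morph Posz PoszD (erefl _)). Qed.

Lemma skew_realization (T : finType) (r : nat) (x : T -> T -> int) :
  skew_ge r x ->
  exists arcs' : T -> T -> nat, [/\ forall v, arcs' v v = 0%N,
    forall u v, u != v -> (arcs' u v + arcs' v u <= r)%N &
    forall u v, (arcs' u v)%:Z - (arcs' v u)%:Z = x u v].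
Proof.
(* With the positive part of [x], each pair is joined in one direction only, by [|x u v|] arcs. *)
move=> [xN xge]; exists (fun u v => `|Num.max 0%R (x u v) : int|%N).
split=> [v|u v _|u v].
- have := xN v v; lia.
- have := xN u v; have := xge u v; have := xge v u; lia.
- have := xN u v; lia.
Qed.

Theorem theorem5 (r : nat) (hr : (1 <= r)%N) (n : nat) (B : n.-tuple int)
    (hB : sorted <=%R B) :
  (exists G : rdigraph r, imbalance_sequence G = B) <->
  (forall k : nat, (1 <= k <= n)%N ->
     \sum_(i < k) B`_i >= r%:Z * k%:Z * (k%:Z - n%:Z)) /\
  \sum_(i < n) B`_i = r%:Z * n%:Z * (n%:Z - n%:Z).
Proof.
rewrite subrr mulr0; split=> [[G GB]|[Bge B0]].
  (* Sorting the vertices themselves makes each partial sum of [B] a sum over a vertex set. *)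
  pose le_imb := relpre (@imbalance r G) <=%R.
  pose vs := sort le_imb (enum (vertex G)).
  have vsB : map (@imbalance r G) vs = B.
    by rewrite -GB /imbalance_sequence sort_map.
  have vs_uniq : uniq vs by rewrite sort_uniq enum_uniq.
  have size_vs : size vs = n.
    by rewrite -(size_map (@imbalance r G)) vsB size_tuple.
  have cardG : #|vertex G| = n by rewrite -size_vs size_sort cardE.
  have sum_take k : (k <= n)%N ->
      \sum_(i < k) B`_i = \sum_(v <- take k vs) row_sum (@net r G) v.
    move=> kn; under [RHS]eq_bigr do rewrite -imbalanceE.
    rewrite -(big_map (@imbalance r G) xpredT id) map_take vsB.
    rewrite (big_nth 0) size_takel ?size_tuple // big_mkord.
    by apply: eq_bigr => i _; rewrite nth_take.
  split=> [k /andP[_ kn]|].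
    pose S := [set v in take k vs].
    have Sk : #|S| = k.
      by rewrite cardsE (card_uniqP _) ?take_uniq // size_takel ?size_vs.
    rewrite sum_take // big_uniq ?take_uniq //=.
    have := skew_sum_row_sum_ge S (net_skew G); rewrite Sk cardG.
    by rewrite (eq_bigl (mem (take k vs))) // => v; rewrite !inE.
  rewrite sum_take // -size_vs take_size big_uniq //=.
  apply: etrans (skew_sum_row_sum0 (net_skew G)); apply: eq_bigl => v.
  by rewrite mem_sort mem_enum.
pose b (i : 'I_n) := B`_i.
have [|x xP xb] := @exists_skew_row_sum 'I_n r b B0.
  move=> S; have := max_card (mem S); rewrite card_ord => Sn.
  (* The hypothesis starts at [k = 1], so the empty set is treated apart. *)
  have [S0|S_gt0] := posnP #|S|.
    by rewrite (cards0_eq S0) big_set0 cards0; lia.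
  apply: le_trans (sum_initial_le (c := nth 0 B) _ erefl).
    by rewrite Bge ?S_gt0.
  move=> i j /andP[ij jn].
  by apply: (sorted_leq_nth le_trans le_refl 0 hB) => //;
    rewrite inE size_tuple // (leq_ltn_trans ij).
have [a [a_loopless a_bound ax]] := skew_realization xP.
exists (RDigraph a_loopless a_bound); rewrite /imbalance_sequence.
set G := RDigraph _ _.
have -> : [seq imbalance v | v <- enum (vertex G)] = B.
  apply: (@eq_from_nth _ 0); rewrite size_map -cardE card_ord ?size_tuple //= => i ilt.
  rewrite (nth_map (Ordinal ilt)) -?cardE ?card_ord // imbalanceE.
  rewrite -[i in nth _ _ i]/(val (Ordinal ilt)) nth_ord_enum.
  by rewrite -[RHS]/(b (Ordinal ilt)) -xb; apply: eq_bigr => j _; rewrite -ax.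
exact: (sorted_sort le_trans).
Qed.
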